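(* Consider the planar system, depending on the parameter $\mu=(\mu_1,\mu_2)\in\mathbb{R}^2$ with $|\mu|$ sufficiently small, $$\frac{d\xi_1}{dt}=\xi_1\left(\mu_1-\theta(\mu)\xi_1+\gamma(\mu)\xi_2-M(\mu)\xi_1\xi_2+N(\mu)\xi_1^2\right),\qquad \frac{d\xi_2}{dt}=\xi_2\left(\mu_2-\delta(\mu)\xi_1+\xi_2+S(\mu)\xi_1^2+P(\mu)\xi_2^2\right),$$ where $\theta,\gamma,\delta,M,N,S,P$ are smooth functions of $\mu$ near $0$; write $\theta=\theta(0)$, $\gamma=\gamma(0)$, $\delta=\delta(0)$, and let $\gamma<0$, $\theta\delta\neq 0$ and $\theta-\gamma\delta\neq 0$. Let $E_3$ be the equilibrium defined in the context, considered for those small $\mu$ for which it lies in the first quadrant ($\xi_1>0$, $\xi_2>0$). 1) If $\theta<0$ or $0<\gamma\delta<\theta$ or $\gamma\delta<0<\theta$, then the system does not undergo a Hopf bifurcation at $E_3$. 2) If $0<\theta<\gamma\delta$, then a Hopf bifurcation (degenerate or not) occurs at $E_3$.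
   Context: Here $|\mu|=\sqrt{\mu_1^2+\mu_2^2}$. The system is studied only in the first quadrant and near the origin. When $\theta-\gamma\delta\ne 0$, $E_3=(\xi_1,\xi_2)$ is the unique solution near the origin (for $|\mu|$ small), given by the Implicit Function Theorem, of $$\mu_1-\theta\xi_1+\gamma\xi_2-M\xi_1\xi_2+N\xi_1^2=0,\qquad \mu_2-\delta\xi_1+\xi_2+S\xi_1^2+P\xi_2^2=0$$ (coefficients evaluated at $\mu$). Its coordinates are $$\xi_1=\tfrac{\mu_1}{\theta-\gamma\delta}(1+O(|\mu|))-\tfrac{\gamma\mu_2}{\theta-\gamma\delta}(1+O(|\mu|)),\qquad \xi_2=\tfrac{\delta\mu_1}{\theta-\gamma\delta}(1+O(|\mu|))-\tfrac{\theta\mu_2}{\theta-\gamma\delta}(1+O(|\mu|)).$$ The eigenvalues of the Jacobian at $E_3$ are written $\lambda_{1,2}=p\pm\sqrt{q}$, where $2p$ is the trace and $p^2-q$ the determinant. ''A Hopf bifurcation (degenerate or not) occurs at $E_3$'' means that there are arbitrarily small parameter values, forming a curve in the $(\mu_1,\mu_2)$-plane with the origin in its closure, at which $E_3$ is in the open first quadrant and has a pair of non-zero purely imaginary eigenvalues ($p=0$, $q<0$), and that this pair crosses the imaginary axis transversally as $\mu_2$ varies ($\partial p/\partial\mu_2\neq 0$ on the curve). No condition on the first Lyapunov coefficient is imposed. ''The system does not undergo a Hopf bifurcation at $E_3$'' means that, for $|\mu|$ sufficiently small, $E_3$ in the open first quadrant never has non-zero purely imaginary eigenvalues. *)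

(* Defs.v *)
From Stdlib Require Import Reals Lra Psatz Nsatz.
From Coquelicot Require Import Coquelicot.
Open Scope R_scope.

Definition enorm (x y : R) : R := sqrt (x ^ 2 + y ^ 2).

(** C^infinity on a neighbourhood of the origin: [ex_diff_n f n] says that all
    iterated partial derivatives of [f] up to order [n] exist and are continuous. *)
Definition smooth_near0 (f : R -> R -> R) : Prop :=
  locally_2d (fun mu1 mu2 => forall n : nat, ex_diff_n f n mu1 mu2) 0 0.

Record coefficients := {
  theta : R -> R -> R;
  gamma : R -> R -> R;
  delta : R -> R -> R;
  cM : R -> R -> R;
  cN : R -> R -> R;
  cS : R -> R -> R;
  cP : R -> R -> R
}.

Definition smooth_coefficients (k : coefficients) : Prop :=
  smooth_near0 (theta k) /\ smooth_near0 (gamma k) /\ smooth_near0 (delta k) /\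
  smooth_near0 (cM k) /\ smooth_near0 (cN k) /\ smooth_near0 (cS k) /\
  smooth_near0 (cP k).

Definition growth1 (k : coefficients) (mu1 mu2 x1 x2 : R) : R :=
  mu1 - theta k mu1 mu2 * x1 + gamma k mu1 mu2 * x2
  - cM k mu1 mu2 * x1 * x2 + cN k mu1 mu2 * x1 ^ 2.

Definition growth2 (k : coefficients) (mu1 mu2 x1 x2 : R) : R :=
  mu2 - delta k mu1 mu2 * x1 + x2
  + cS k mu1 mu2 * x1 ^ 2 + cP k mu1 mu2 * x2 ^ 2.

Definition field1 (k : coefficients) (mu1 mu2 x1 x2 : R) : R :=
  x1 * growth1 k mu1 mu2 x1 x2.

Definition field2 (k : coefficients) (mu1 mu2 x1 x2 : R) : R :=
  x2 * growth2 k mu1 mu2 x1 x2.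

Record mat2 := Mat2 { m11 : R; m12 : R; m21 : R; m22 : R }.

Definition jacobian (k : coefficients) (mu1 mu2 : R) (x : R * R) : mat2 :=
  Mat2 (Derive (fun z => field1 k mu1 mu2 z (snd x)) (fst x))
       (Derive (fun z => field1 k mu1 mu2 (fst x) z) (snd x))
       (Derive (fun z => field2 k mu1 mu2 z (snd x)) (fst x))
       (Derive (fun z => field2 k mu1 mu2 (fst x) z) (snd x)).

Definition eigenvalue (A : mat2) (l : C) : Prop :=
  exists v1 v2 : C,
    ~ (v1 = RtoC 0 /\ v2 = RtoC 0) /\
    Cplus (Cmult (RtoC (m11 A)) v1) (Cmult (RtoC (m12 A)) v2) = Cmult l v1 /\
    Cplus (Cmult (RtoC (m21 A)) v1) (Cmult (RtoC (m22 A)) v2) = Cmult l v2.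

Definition imaginary_pair (A : mat2) : Prop :=
  exists w : R, w <> 0 /\ eigenvalue A (0, w) /\ eigenvalue A (0, - w).

(** The eigenvalues are [p +- sqrt q] with [p = eig_p A], [q = eig_q A]: [2 p] is the trace and
    [p ^ 2 - q] the determinant. *)
Definition eig_p (A : mat2) : R := (m11 A + m22 A) / 2.
Definition eig_q (A : mat2) : R :=
  eig_p A ^ 2 - (m11 A * m22 A - m12 A * m21 A).

Lemma imaginary_pairE (A : mat2) :
  imaginary_pair A <-> eig_p A = 0 /\ eig_q A < 0.
Proof.
destruct A as [a b c d]; unfold imaginary_pair, eigenvalue, eig_q, eig_p; simpl.
split.
- intros [w [w0 [[[x1 y1] [[x2 y2] [nz [e1 e2]]]] _]]].
  unfold Cplus, Cmult, RtoC in e1, e2; simpl in e1, e2.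
  injection e1 as e1r e1i; injection e2 as e2r e2i.
  set (D := a * d - b * c - w * w); set (T := w * (a + d)).
  assert (A1 : D * x1 + T * y1 = 0) by (unfold D, T; nsatz).
  assert (A2 : D * y1 - T * x1 = 0) by (unfold D, T; nsatz).
  assert (A3 : D * x2 + T * y2 = 0) by (unfold D, T; nsatz).
  assert (A4 : D * y2 - T * x2 = 0) by (unfold D, T; nsatz).
  assert (S0 : (D * D + T * T) * (x1 * x1 + y1 * y1) = 0).
  { replace ((D * D + T * T) * (x1 * x1 + y1 * y1))
      with ((D * x1 + T * y1) ^ 2 + (D * y1 - T * x1) ^ 2) by ring.
    rewrite A1, A2; ring. }
  assert (S1 : (D * D + T * T) * (x2 * x2 + y2 * y2) = 0).
  { replace ((D * D + T * T) * (x2 * x2 + y2 * y2))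
      with ((D * x2 + T * y2) ^ 2 + (D * y2 - T * x2) ^ 2) by ring.
    rewrite A3, A4; ring. }
  assert (DT : D * D + T * T = 0).
  { destruct (Rmult_integral _ _ S0) as [h|h1]; [exact h|].
    destruct (Rmult_integral _ _ S1) as [h|h2]; [exact h|].
    exfalso; apply nz; unfold RtoC; split; f_equal; nra. }
  assert (D0 : D = 0) by nra.
  assert (T0 : T = 0) by nra.
  unfold D in D0; unfold T in T0.
  destruct (Rmult_integral _ _ T0) as [h|h]; [contradiction|].
  split; [lra|].
  replace ((a + d) / 2) with 0 by lra.
  assert (0 < w * w) by nra.
  nra.
- intros [p0 q0].
  assert (Hd : d = - a) by lra; subst d.
  replace ((a + - a) / 2) with 0 in q0 by lra.
  set (D := a * - a - b * c) in *.
  assert (HD : 0 < D) by lra.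
  assert (b0 : b <> 0) by (intros h; unfold D in HD; rewrite h in HD; pose proof (Rle_0_sqr a); unfold Rsqr in *; lra).
  assert (hs : sqrt D * sqrt D = D) by (apply sqrt_sqrt; lra).
  assert (key : forall w, w * w = D -> exists v1 v2 : C,
    ~ (v1 = RtoC 0 /\ v2 = RtoC 0) /\
    Cplus (Cmult (RtoC a) v1) (Cmult (RtoC b) v2) = Cmult (0, w) v1 /\
    Cplus (Cmult (RtoC c) v1) (Cmult (RtoC (- a)) v2) = Cmult (0, w) v2).
  { intros w hw; exists (b, 0), (- a, w).
    unfold Cplus, Cmult, RtoC; simpl; split.
    - intros [h _]; injection h as h; contradiction.
    - unfold D in hw; split; f_equal; nra. }
  exists (sqrt D); split; [|split; apply key].
  + apply Rgt_not_eq, sqrt_lt_R0; exact HD.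
  + exact hs.
  + rewrite <- hs at 3; ring.
Qed.

(** [E mu1 mu2] is the unique solution near the origin, for small parameters.
    Values of [E] outside the ball of radius [eps] are irrelevant; under the
    non-degeneracy condition two such [E] agree for all small parameters, since
    the implicit function theorem puts the solution in every ball of radius [r]. *)
Definition is_E3 (k : coefficients) (E : R -> R -> R * R) : Prop :=
  exists r eps : R, 0 < r /\ 0 < eps /\
    forall mu1 mu2 : R, enorm mu1 mu2 < eps ->
      enorm (fst (E mu1 mu2)) (snd (E mu1 mu2)) < r /\
      growth1 k mu1 mu2 (fst (E mu1 mu2)) (snd (E mu1 mu2)) = 0 /\
      growth2 k mu1 mu2 (fst (E mu1 mu2)) (snd (E mu1 mu2)) = 0 /\
      forall x1 x2 : R, enorm x1 x2 < r ->
        growth1 k mu1 mu2 x1 x2 = 0 -> growth2 k mu1 mu2 x1 x2 = 0 ->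
        (x1, x2) = E mu1 mu2.

Definition in_open_quadrant (x : R * R) : Prop := 0 < fst x /\ 0 < snd x.

Definition jacobian_at (k : coefficients) (E : R -> R -> R * R) (mu1 mu2 : R) : mat2 :=
  jacobian k mu1 mu2 (E mu1 mu2).

Definition no_Hopf (k : coefficients) (E : R -> R -> R * R) : Prop :=
  exists eps : R, 0 < eps /\
    forall mu1 mu2 : R, enorm mu1 mu2 < eps ->
      in_open_quadrant (E mu1 mu2) -> ~ imaginary_pair (jacobian_at k E mu1 mu2).

Definition transversal_crossing (k : coefficients) (E : R -> R -> R * R)
    (mu1 mu2 : R) : Prop :=
  exists d : R,
    is_derive (fun m : R => eig_p (jacobian_at k E mu1 m)) mu2 d /\ d <> 0.

Definition Hopf_point (k : coefficients) (E : R -> R -> R * R) (mu1 mu2 : R) : Prop :=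
  in_open_quadrant (E mu1 mu2) /\
  imaginary_pair (jacobian_at k E mu1 mu2) /\
  transversal_crossing k E mu1 mu2.

Definition simple_arc (c : R -> R * R) : Prop :=
  (forall t : R, 0 < t < 1 -> continuous c t) /\
  (forall s t : R, 0 < s < 1 -> 0 < t < 1 -> c s = c t -> s = t).

Definition origin_in_closure (c : R -> R * R) : Prop :=
  forall eta : R, 0 < eta ->
    exists t : R, 0 < t < 1 /\ enorm (fst (c t)) (snd (c t)) < eta.

(** Asking for a curve of Hopf points inside every ball around the origin makes the notion
    depend only on the values of [E] at small parameters. *)
Definition Hopf_bifurcation (k : coefficients) (E : R -> R -> R * R) : Prop :=
  forall eps : R, 0 < eps ->
    exists c : R -> R * R,
      simple_arc c /\ origin_in_closure c /\
      forall t : R, 0 < t < 1 ->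
        enorm (fst (c t)) (snd (c t)) < eps /\ Hopf_point k E (fst (c t)) (snd (c t)).

(* Main.v *)
Require Import Defs.
From Stdlib Require Import Reals Lra Ranalysis5 ClassicalEpsilon.
From Coquelicot Require Import Coquelicot.
Open Scope R_scope.

(** At [E3] the two growth rates vanish, so the Jacobian is [diag (x1, x2)] times the Jacobian
    of the growth rates, which is close to [[-theta, gamma; -delta, 1]]. Hence in the open
    quadrant the eigenvalues are purely imaginary iff the trace
    [x1 (- theta + o(1)) + x2 (1 + o(1))] vanishes and [gamma delta - theta + o(1) > 0];
    this is impossible near the origin in case 1.
    In case 2 the trace along [E3] has [mu2]-derivative tending to
    [theta (1 - gamma) / (gamma delta - theta) > 0], so its zero set is a graph [mu2 = h mu1],
    and for [mu1 > 0] the equations [trace = 0], [growth1 = 0] force [E3] into the quadrant.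
    Instead of the implicit function theorem, [E3] is found by solving [growth1 = 0] for [x2]
    ([gamma <> 0]) and applying the intermediate value theorem in [x1]; its uniqueness,
    continuity and differentiability follow from the exact identity
    [growth mu x - growth mu y = K mu x y (x - y)] with [K] invertible near the origin. *)

(** * Limits of real functions along an arbitrary filter *)

Lemma lim_plus {T : Type} {F : (T -> Prop) -> Prop} {FF : Filter F} (f g : T -> R) (a b : R) :
  filterlim f F (locally a) -> filterlim g F (locally b) ->
  filterlim (fun t => f t + g t) F (locally (a + b)).
Proof.
intros hf hg; exact (filterlim_comp_2 f g Rplus hf hg (filterlim_plus a b)).
Qed.

Lemma lim_mult {T : Type} {F : (T -> Prop) -> Prop} {FF : Filter F} (f g : T -> R) (a b : R) :
  filterlim f F (locally a) -> filterlim g F (locally b) ->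
  filterlim (fun t => f t * g t) F (locally (a * b)).
Proof.
intros hf hg; exact (filterlim_comp_2 f g Rmult hf hg (filterlim_mult a b)).
Qed.

Lemma lim_opp {T : Type} {F : (T -> Prop) -> Prop} {FF : Filter F} (f : T -> R) (a : R) :
  filterlim f F (locally a) -> filterlim (fun t => - f t) F (locally (- a)).
Proof.
intros hf; exact (filterlim_comp _ _ _ f Ropp _ _ _ hf (filterlim_opp a)).
Qed.

Lemma lim_minus {T : Type} {F : (T -> Prop) -> Prop} {FF : Filter F} (f g : T -> R) (a b : R) :
  filterlim f F (locally a) -> filterlim g F (locally b) ->
  filterlim (fun t => f t - g t) F (locally (a - b)).
Proof. intros hf hg; exact (lim_plus _ _ _ _ hf (lim_opp _ _ hg)). Qed.

Lemma lim_inv {T : Type} {F : (T -> Prop) -> Prop} {FF : Filter F} (f : T -> R) (a : R) :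
  a <> 0 -> filterlim f F (locally a) -> filterlim (fun t => / f t) F (locally (/ a)).
Proof.
intros ha hf.
apply (filterlim_comp _ _ _ f Rinv _ _ _ hf).
apply (continuous_Rinv_comp (fun x => x) a); [apply filterlim_id|exact ha].
Qed.

Lemma lim_div {T : Type} {F : (T -> Prop) -> Prop} {FF : Filter F} (f g : T -> R) (a b : R) :
  filterlim f F (locally a) -> filterlim g F (locally b) -> b <> 0 ->
  filterlim (fun t => f t / g t) F (locally (a / b)).
Proof. intros hf hg hb; exact (lim_mult _ _ _ _ hf (lim_inv _ _ hb hg)). Qed.

Lemma lim_sq {T : Type} {F : (T -> Prop) -> Prop} {FF : Filter F} (f : T -> R) (a : R) :
  filterlim f F (locally a) -> filterlim (fun t => f t ^ 2) F (locally (a ^ 2)).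
Proof.
intros hf; apply lim_mult; [exact hf|apply lim_mult; [exact hf|apply filterlim_const]].
Qed.

Lemma lim_abs {T : Type} {F : (T -> Prop) -> Prop} {FF : Filter F} (f : T -> R) (a : R) :
  filterlim f F (locally a) -> filterlim (fun t => Rabs (f t)) F (locally (Rabs a)).
Proof.
intros hf; exact (filterlim_comp _ _ _ f Rabs _ _ _ hf (continuous_Rabs a)).
Qed.

(** Quotients are tried before products: [lim_mult] could unfold a quotient and leave an inverse
    that no rule of the list treats. Side conditions [b <> 0] are closed by [eassumption] or left to
    the caller. *)
Ltac lim :=
  repeat first
    [ eassumption
    | apply filterlim_const
    | apply lim_plus | apply lim_minus | apply lim_div | apply lim_mult | apply lim_opp
    | apply lim_sq ].

Lemma lim_eq {T : Type} {F : (T -> Prop) -> Prop} (f : T -> R) (a b : R) :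
  filterlim f F (locally a) -> a = b -> filterlim f F (locally b).
Proof. intros h e; rewrite <- e; exact h. Qed.

Lemma lim_gt {T : Type} {F : (T -> Prop) -> Prop} {FF : Filter F} (f : T -> R) (a c : R) :
  filterlim f F (locally a) -> c < a -> F (fun t => c < f t).
Proof. intros hf ha; exact (hf _ (open_gt c a ha)). Qed.

Lemma lim_lt {T : Type} {F : (T -> Prop) -> Prop} {FF : Filter F} (f : T -> R) (a c : R) :
  filterlim f F (locally a) -> a < c -> F (fun t => f t < c).
Proof. intros hf ha; exact (hf _ (open_lt c a ha)). Qed.

Lemma lim_bounded {T : Type} {F : (T -> Prop) -> Prop} {FF : Filter F} (f : T -> R) (a : R) :
  filterlim f F (locally a) -> F (fun t => Rabs (f t) < Rabs a + 1).
Proof. intros hf; apply (lim_lt _ (Rabs a)); [apply lim_abs, hf|lra]. Qed.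

Lemma lim_neq0 {T : Type} {F : (T -> Prop) -> Prop} {FF : Filter F} (f : T -> R) (a : R) :
  filterlim f F (locally a) -> a <> 0 -> F (fun t => f t <> 0).
Proof.
intros hf ha.
apply filter_imp with (fun t => 0 < Rabs (f t)).
- intros t ht e; rewrite e, Rabs_R0 in ht; lra.
- apply (lim_gt _ (Rabs a)); [apply lim_abs, hf|apply Rabs_pos_lt, ha].
Qed.

Lemma lim_squeeze {T : Type} {F : (T -> Prop) -> Prop} {FF : Filter F} (f g : T -> R) (a : R) :
  F (fun t => Rabs (f t - a) <= g t) -> filterlim g F (locally 0) -> filterlim f F (locally a).
Proof.
intros hfg hg; apply filterlim_locally; intros eps.
apply (filter_imp (fun t => Rabs (f t - a) <= g t /\ g t < eps)).
- intros t [h1 h2]; change (Rabs (f t - a) < eps); lra.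
- apply filter_and; [exact hfg|apply (lim_lt _ 0); [exact hg|apply cond_pos]].
Qed.

Lemma lim_close {T : Type} {F : (T -> Prop) -> Prop} {FF : Filter F} (f : T -> R) (a e : R) :
  filterlim f F (locally a) -> 0 < e -> F (fun t => Rabs (f t - a) < e).
Proof. intros hf he; exact (proj1 (filterlim_locally f a) hf (mkposreal e he)). Qed.

(** * Neighbourhoods of the origin *)

Definition small (r : R) (p : R * R) : Prop := Rabs (fst p) < r /\ Rabs (snd p) < r.

Lemma locally_small (P : R * R -> Prop) :
  locally (0, 0) P <-> exists r, 0 < r /\ forall p, small r p -> P p.
Proof.
assert (hb : forall r p, ball ((0, 0) : R * R) r p <-> small r p).
{ intros r [u v].
  change ((Rabs (u - 0) < r /\ Rabs (v - 0) < r) <-> small r (u, v)).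
  rewrite !Rminus_0_r; reflexivity. }
split.
- intros [r hr]; exists r; split; [apply cond_pos|].
  intros p hp; apply hr, hb, hp.
- intros [r [r0 hr]]; exists (mkposreal r r0); intros p hp; apply hr, hb, hp.
Qed.

Lemma enorm_small (r u v : R) : enorm u v < r -> small r (u, v).
Proof.
intros h; split; simpl; apply Rle_lt_trans with (2 := h); unfold enorm;
  rewrite <- sqrt_Rsqr_abs; apply sqrt_le_1_alt; unfold Rsqr; nra.
Qed.

Lemma small_enorm (r u v : R) : small (r / 2) (u, v) -> enorm u v < r.
Proof.
intros [hu hv]; simpl in hu, hv.
apply Rabs_def2 in hu; apply Rabs_def2 in hv.
assert (0 < r) by lra.
unfold enorm; rewrite <- (sqrt_Rsqr r) by lra.
apply sqrt_lt_1_alt; unfold Rsqr; nra.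
Qed.

(** Translates between the Euclidean balls of the statement and the product filter along which all
    limits are taken. *)
Lemma locally_enorm (P : R * R -> Prop) :
  locally (0, 0) P <-> exists r, 0 < r /\ forall u v, enorm u v < r -> P (u, v).
Proof.
rewrite locally_small; split.
- intros [r [r0 hr]]; exists r; split; [exact r0|].
  intros u v h; apply hr, enorm_small, h.
- intros [r [r0 hr]]; exists (r / 2); split; [lra|].
  intros [u v] h; apply hr, small_enorm, h.
Qed.

(** * Regularity of the coefficients *)

Definition coef_cont (k : coefficients) (p : R * R) : Prop :=
  filterlim (fun q => theta k (fst q) (snd q)) (locally p) (locally (theta k (fst p) (snd p))) /\
  filterlim (fun q => gamma k (fst q) (snd q)) (locally p) (locally (gamma k (fst p) (snd p))) /\
  filterlim (fun q => delta k (fst q) (snd q)) (locally p) (locally (delta k (fst p) (snd p))) /\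
  filterlim (fun q => cM k (fst q) (snd q)) (locally p) (locally (cM k (fst p) (snd p))) /\
  filterlim (fun q => cN k (fst q) (snd q)) (locally p) (locally (cN k (fst p) (snd p))) /\
  filterlim (fun q => cS k (fst q) (snd q)) (locally p) (locally (cS k (fst p) (snd p))) /\
  filterlim (fun q => cP k (fst q) (snd q)) (locally p) (locally (cP k (fst p) (snd p))).

Definition D2 (f : R -> R -> R) (p : R * R) : R := Derive (fun m => f (fst p) m) (snd p).

Lemma smooth_cont (f : R -> R -> R) : smooth_near0 f ->
  locally (0, 0) (fun p =>
    filterlim (fun q => f (fst q) (snd q)) (locally p) (locally (f (fst p) (snd p)))).
Proof.
intros hf; apply locally_2d_locally in hf; revert hf; apply filter_imp.
intros [u v] h; apply continuity_2d_pt_filterlim; exact (proj1 (h 0%nat)).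
Qed.

Lemma smooth_D2 (f : R -> R -> R) : smooth_near0 f ->
  locally (0, 0) (fun p => is_derive (fun m => f (fst p) m) (snd p) (D2 f p)) /\
  filterlim (D2 f) (locally (0, 0)) (locally (D2 f (0, 0))).
Proof.
intros hf; apply locally_2d_locally in hf; split.
- revert hf; apply filter_imp; intros [u v] h; apply Derive_correct.
  exact (proj1 (proj2 (proj2 (h 1%nat)))).
- apply locally_singleton in hf.
  (* The last component of [ex_diff_n f 1] is [ex_diff_n] of order 0 for the [mu2]-derivative, which
     starts with its continuity. *)
  destruct (hf 1%nat) as [_ [_ [_ [_ [h _]]]]].
  apply continuity_2d_pt_filterlim in h; exact h.
Qed.

Lemma coef_cont_near0 (k : coefficients) :
  smooth_coefficients k -> locally (0, 0) (coef_cont k).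
Proof.
intros [h1 [h2 [h3 [h4 [h5 [h6 h7]]]]]].
repeat (apply filter_and; [apply smooth_cont; assumption|]); apply smooth_cont; assumption.
Qed.

Lemma coef_lim (k : coefficients) {T : Type} {F : (T -> Prop) -> Prop} {FF : Filter F}
    (g : T -> R * R) (p : R * R) :
  coef_cont k p -> filterlim g F (locally p) ->
  filterlim (fun t => theta k (fst (g t)) (snd (g t))) F (locally (theta k (fst p) (snd p))) /\
  filterlim (fun t => gamma k (fst (g t)) (snd (g t))) F (locally (gamma k (fst p) (snd p))) /\
  filterlim (fun t => delta k (fst (g t)) (snd (g t))) F (locally (delta k (fst p) (snd p))) /\
  filterlim (fun t => cM k (fst (g t)) (snd (g t))) F (locally (cM k (fst p) (snd p))) /\
  filterlim (fun t => cN k (fst (g t)) (snd (g t))) F (locally (cN k (fst p) (snd p))) /\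
  filterlim (fun t => cS k (fst (g t)) (snd (g t))) F (locally (cS k (fst p) (snd p))) /\
  filterlim (fun t => cP k (fst (g t)) (snd (g t))) F (locally (cP k (fst p) (snd p))).
Proof.
intros [h1 [h2 [h3 [h4 [h5 [h6 h7]]]]]] hg.
exact (conj (filterlim_comp _ _ _ g _ _ _ _ hg h1)
  (conj (filterlim_comp _ _ _ g _ _ _ _ hg h2)
  (conj (filterlim_comp _ _ _ g _ _ _ _ hg h3)
  (conj (filterlim_comp _ _ _ g _ _ _ _ hg h4)
  (conj (filterlim_comp _ _ _ g _ _ _ _ hg h5)
  (conj (filterlim_comp _ _ _ g _ _ _ _ hg h6)
  (filterlim_comp _ _ _ g _ _ _ _ hg h7))))))).
Qed.

Lemma lim_components {T : Type} {F : (T -> Prop) -> Prop} {FF : Filter F}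
    (g : T -> R * R) (p : R * R) :
  filterlim g F (locally p) <->
  filterlim (fun t => fst (g t)) F (locally (fst p)) /\
  filterlim (fun t => snd (g t)) F (locally (snd p)).
Proof.
destruct p as [u v]; split.
- intros hg; split.
  + exact (filterlim_comp _ _ _ g fst _ _ _ hg (continuous_fst u v)).
  + exact (filterlim_comp _ _ _ g snd _ _ _ hg (continuous_snd u v)).
- intros [h1 h2]; apply filterlim_locally; intros eps.
  apply filterlim_locally with (eps := eps) in h1.
  apply filterlim_locally with (eps := eps) in h2.
  generalize (filter_and _ _ h1 h2); apply filter_imp; intros t [a b]; split; assumption.
Qed.

(** * The growth rates and their secant matrix *)

Lemma growth_lim (k : coefficients) {T : Type} {F : (T -> Prop) -> Prop} {FF : Filter F}
    (g x : T -> R * R) (p y : R * R) :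
  coef_cont k p -> filterlim g F (locally p) -> filterlim x F (locally y) ->
  filterlim (fun t => growth1 k (fst (g t)) (snd (g t)) (fst (x t)) (snd (x t))) F
    (locally (growth1 k (fst p) (snd p) (fst y) (snd y))) /\
  filterlim (fun t => growth2 k (fst (g t)) (snd (g t)) (fst (x t)) (snd (x t))) F
    (locally (growth2 k (fst p) (snd p) (fst y) (snd y))).
Proof.
intros hk hg hx.
destruct (coef_lim k g p hk hg) as [h1 [h2 [h3 [h4 [h5 [h6 h7]]]]]].
apply lim_components in hg; destruct hg as [hg1 hg2].
apply lim_components in hx; destruct hx as [hx1 hx2].
unfold growth1, growth2; split; lim.
Qed.

(** Entries of the matrix [K] with [growth mu x - growth mu y = K (x - y)]; on the diagonal
    [x = y] it is the Jacobian of [growth]. *)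
Definition sec11 (k : coefficients) (p x y : R * R) : R :=
  - theta k (fst p) (snd p) - cM k (fst p) (snd p) * snd x
  + cN k (fst p) (snd p) * (fst x + fst y).
Definition sec12 (k : coefficients) (p y : R * R) : R :=
  gamma k (fst p) (snd p) - cM k (fst p) (snd p) * fst y.
Definition sec21 (k : coefficients) (p x y : R * R) : R :=
  - delta k (fst p) (snd p) + cS k (fst p) (snd p) * (fst x + fst y).
Definition sec22 (k : coefficients) (p x y : R * R) : R :=
  1 + cP k (fst p) (snd p) * (snd x + snd y).
Definition secdet (k : coefficients) (p x y : R * R) : R :=
  sec11 k p x y * sec22 k p x y - sec12 k p y * sec21 k p x y.

(** The mixed term splits as [x1 x2 - y1 y2 = x2 (x1 - y1) + y1 (x2 - y2)]; hence [snd x] in [sec11]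
    and [fst y] in [sec12]. *)
Lemma growth_sub1 (k : coefficients) (p x y : R * R) :
  growth1 k (fst p) (snd p) (fst x) (snd x) - growth1 k (fst p) (snd p) (fst y) (snd y)
  = sec11 k p x y * (fst x - fst y) + sec12 k p y * (snd x - snd y).
Proof. unfold growth1, sec11, sec12; ring. Qed.

Lemma growth_sub2 (k : coefficients) (p x y : R * R) :
  growth2 k (fst p) (snd p) (fst x) (snd x) - growth2 k (fst p) (snd p) (fst y) (snd y)
  = sec21 k p x y * (fst x - fst y) + sec22 k p x y * (snd x - snd y).
Proof. unfold growth2, sec21, sec22; ring. Qed.

(** Cramer's rule for [K (x - y) = - growth y], valid when [x] is a root. It yields uniqueness when
    [y] is a root for the same parameter, and continuity and differentiability of the branch when
    [y] is a root for a nearby parameter. *)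
Lemma secant_solve1 (k : coefficients) (p x y : R * R) :
  secdet k p x y <> 0 ->
  growth1 k (fst p) (snd p) (fst x) (snd x) = 0 ->
  growth2 k (fst p) (snd p) (fst x) (snd x) = 0 ->
  fst x - fst y =
    growth1 k (fst p) (snd p) (fst y) (snd y) * - (sec22 k p x y / secdet k p x y)
    + growth2 k (fst p) (snd p) (fst y) (snd y) * (sec12 k p y / secdet k p x y).
Proof.
intros hd h1 h2.
assert (e1 := growth_sub1 k p x y); assert (e2 := growth_sub2 k p x y).
rewrite h1, Rminus_0_l in e1; rewrite h2, Rminus_0_l in e2.
apply Ropp_eq_compat in e1; apply Ropp_eq_compat in e2; rewrite Ropp_involutive in e1, e2.
rewrite e1, e2; unfold secdet in *; field; exact hd.
Qed.

Lemma secant_solve2 (k : coefficients) (p x y : R * R) :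
  secdet k p x y <> 0 ->
  growth1 k (fst p) (snd p) (fst x) (snd x) = 0 ->
  growth2 k (fst p) (snd p) (fst x) (snd x) = 0 ->
  snd x - snd y =
    growth1 k (fst p) (snd p) (fst y) (snd y) * (sec21 k p x y / secdet k p x y)
    + growth2 k (fst p) (snd p) (fst y) (snd y) * - (sec11 k p x y / secdet k p x y).
Proof.
intros hd h1 h2.
assert (e1 := growth_sub1 k p x y); assert (e2 := growth_sub2 k p x y).
rewrite h1, Rminus_0_l in e1; rewrite h2, Rminus_0_l in e2.
apply Ropp_eq_compat in e1; apply Ropp_eq_compat in e2; rewrite Ropp_involutive in e1, e2.
rewrite e1, e2; unfold secdet in *; field; exact hd.
Qed.

Lemma secant_lim (k : coefficients) {T : Type} {F : (T -> Prop) -> Prop} {FF : Filter F}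
    (g x y : T -> R * R) (p a b : R * R) :
  coef_cont k p -> filterlim g F (locally p) ->
  filterlim x F (locally a) -> filterlim y F (locally b) ->
  filterlim (fun t => sec11 k (g t) (x t) (y t)) F (locally (sec11 k p a b)) /\
  filterlim (fun t => sec12 k (g t) (y t)) F (locally (sec12 k p b)) /\
  filterlim (fun t => sec21 k (g t) (x t) (y t)) F (locally (sec21 k p a b)) /\
  filterlim (fun t => sec22 k (g t) (x t) (y t)) F (locally (sec22 k p a b)) /\
  filterlim (fun t => secdet k (g t) (x t) (y t)) F (locally (secdet k p a b)).
Proof.
intros hk hg hx hy.
destruct (coef_lim k g p hk hg) as [h1 [h2 [h3 [h4 [h5 [h6 h7]]]]]].
apply lim_components in hx; destruct hx as [hx1 hx2].
apply lim_components in hy; destruct hy as [hy1 hy2].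
unfold secdet, sec11, sec12, sec21, sec22; repeat apply conj; lim.
Qed.

Lemma secdet_at0 (k : coefficients) :
  secdet k (0, 0) (0, 0) (0, 0) = gamma k 0 0 * delta k 0 0 - theta k 0 0.
Proof. unfold secdet, sec11, sec12, sec21, sec22; simpl; ring. Qed.

(** At the origin [K] has determinant [gamma delta - theta <> 0], so by continuity [K] stays
    invertible with bounded inverse nearby. *)
Lemma secant_inverse (k : coefficients) :
  coef_cont k (0, 0) -> theta k 0 0 - gamma k 0 0 * delta k 0 0 <> 0 ->
  exists r B, 0 < r /\ forall p x y, small r p -> small r x -> small r y ->
    secdet k p x y <> 0 /\
    Rabs (sec22 k p x y / secdet k p x y) <= B /\ Rabs (sec12 k p y / secdet k p x y) <= B /\
    Rabs (sec21 k p x y / secdet k p x y) <= B /\ Rabs (sec11 k p x y / secdet k p x y) <= B.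
Proof.
intros hk hnd.
set (o := ((0, 0) : R * R)).
(* A triple product of filters, because [p], [x] and [y] vary independently. *)
set (F := filter_prod (locally o) (filter_prod (locally o) (locally o))).
assert (FF : Filter F) by (unfold F; typeclasses eauto).
destruct (@secant_lim k _ F FF fst (fun t => fst (snd t)) (fun t => snd (snd t)) o o o hk)
  as [h1 [h2 [h3 [h4 h5]]]].
- apply filterlim_fst.
- apply (filterlim_comp _ _ _ snd fst F (filter_prod (locally o) (locally o)));
    [apply filterlim_snd|apply filterlim_fst].
- apply (filterlim_comp _ _ _ snd snd F (filter_prod (locally o) (locally o)));
    [apply filterlim_snd|apply filterlim_snd].
- assert (hd : secdet k o o o <> 0) by (unfold o; rewrite secdet_at0; lra).
  assert (b1 := lim_bounded _ _ (lim_div _ _ _ _ h1 h5 hd)).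
  assert (b2 := lim_bounded _ _ (lim_div _ _ _ _ h2 h5 hd)).
  assert (b3 := lim_bounded _ _ (lim_div _ _ _ _ h3 h5 hd)).
  assert (b4 := lim_bounded _ _ (lim_div _ _ _ _ h4 h5 hd)).
  assert (b5 := lim_neq0 _ _ h5 hd).
  assert (b := filter_and _ _ b5 (filter_and _ _ b4 (filter_and _ _ b2 (filter_and _ _ b3 b1)))).
  destruct b as [P Q hP [Q1 Q2 hQ1 hQ2 hQ] h].
  destruct (proj1 (locally_small _) (filter_and _ _ hP (filter_and _ _ hQ1 hQ2))) as [r [r0 hr]].
  (* The four bounds supplied by [lim_bounded] are read off the type of [h]. Each is positive, so
     their sum serves as a common bound. *)
  match type of h with forall p q, _ -> _ -> _ /\ _ < ?c4 /\ _ < ?c2 /\ _ < ?c3 /\ _ < ?c1 =>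
    exists r, (c1 + c2 + c3 + c4) end.
  split; [exact r0|]; intros p x y hp hx hy.
  destruct (h p (x, y)) as [q1 [q2 [q3 [q4 q5]]]].
  + apply hr, hp.
  + apply hQ; [apply (hr x hx)|apply (hr y hy)].
  + simpl in *.
    assert (d2 := Rle_lt_trans _ _ _ (Rabs_pos _) q2).
    assert (d3 := Rle_lt_trans _ _ _ (Rabs_pos _) q3).
    assert (d4 := Rle_lt_trans _ _ _ (Rabs_pos _) q4).
    assert (d5 := Rle_lt_trans _ _ _ (Rabs_pos _) q5).
    split; [exact q1|repeat split; lra].
Qed.

(** * Existence of small equilibria *)

(** Since [growth1] is affine in [x2], the equation [growth1 = 0] at [x1 = s] has this explicit
    solution [x2]. *)
Definition nullcline (k : coefficients) (p : R * R) (s : R) : R :=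
  - (fst p - theta k (fst p) (snd p) * s + cN k (fst p) (snd p) * s ^ 2)
  / (gamma k (fst p) (snd p) - cM k (fst p) (snd p) * s).

Lemma nullcline_lim (k : coefficients) {T : Type} {F : (T -> Prop) -> Prop} {FF : Filter F}
    (g : T -> R * R) (s : T -> R) (p : R * R) (a : R) :
  coef_cont k p -> filterlim g F (locally p) -> filterlim s F (locally a) ->
  gamma k (fst p) (snd p) - cM k (fst p) (snd p) * a <> 0 ->
  filterlim (fun t => nullcline k (g t) (s t)) F (locally (nullcline k p a)).
Proof.
intros hk hg hs hn.
destruct (coef_lim k g p hk hg) as [h1 [h2 [h3 [h4 [h5 [h6 h7]]]]]].
apply lim_components in hg; destruct hg as [hg1 hg2].
unfold nullcline; lim.
Qed.

Lemma growth1_nullcline (k : coefficients) (p : R * R) (s : R) :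
  gamma k (fst p) (snd p) - cM k (fst p) (snd p) * s <> 0 ->
  growth1 k (fst p) (snd p) s (nullcline k p s) = 0.
Proof. intros h; unfold growth1, nullcline; field; exact h. Qed.

Lemma nullcline_small (k : coefficients) (rho : R) :
  coef_cont k (0, 0) -> gamma k 0 0 < 0 -> 0 < rho ->
  exists r, 0 < r /\ forall p s, small r p -> Rabs s < r ->
    Rabs (nullcline k p s) < rho /\
    gamma k (fst p) (snd p) - cM k (fst p) (snd p) * s <> 0.
Proof.
intros hk hg hrho.
set (F := filter_prod (locally ((0, 0) : R * R)) (locally (0 : R))).
assert (FF : Filter F) by (unfold F; typeclasses eauto).
assert (l1 : filterlim (@fst (R * R) R) F (locally ((0, 0) : R * R))) by apply filterlim_fst.
assert (l2 : filterlim (@snd (R * R) R) F (locally 0)) by apply filterlim_snd.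
assert (hn : gamma k 0 0 - cM k 0 0 * 0 <> 0) by lra.
assert (a1 := lim_close _ _ rho (nullcline_lim k fst snd (0, 0) 0 hk l1 l2 hn) hrho).
destruct (coef_lim k fst (0, 0) hk l1) as [_ [h2 [_ [h4 _]]]].
assert (a2 := lim_neq0 _ _ (lim_minus _ _ _ _ h2 (lim_mult _ _ _ _ h4 l2)) hn).
destruct (filter_and _ _ a1 a2) as [P Q hP [e hQ] h].
destruct (proj1 (locally_small _) hP) as [r [r0 hr]].
exists (Rmin r e); split; [apply Rmin_pos; [exact r0|apply cond_pos]|].
intros p s [hp1 hp2] hs.
assert (m1 := Rmin_l r e); assert (m2 := Rmin_r r e).
destruct (h p s) as [q1 q2].
- apply hr; split; lra.
- apply hQ; change (Rabs (s - 0) < e); rewrite Rminus_0_r; lra.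
- split; [|exact q2].
  simpl in q1; replace (nullcline k (0, 0) 0) with 0 in q1; [rewrite Rminus_0_r in q1; exact q1|].
  unfold nullcline; simpl; field; lra.
Qed.

(** Along the nullcline only [growth2 = 0] remains, an equation [G p s = 0] in one unknown. At
    [mu = 0], [G] changes sign at [s = 0] because its slope there is nonzero; the signs at two fixed
    points [- s] and [s] persist for small [mu], and the intermediate value theorem gives a root
    between them. *)
Lemma small_roots (k : coefficients) (rho : R) :
  coef_cont k (0, 0) -> gamma k 0 0 < 0 -> theta k 0 0 - gamma k 0 0 * delta k 0 0 <> 0 ->
  0 < rho ->
  locally (0, 0) (fun p => exists x, small rho x /\
    growth1 k (fst p) (snd p) (fst x) (snd x) = 0 /\
    growth2 k (fst p) (snd p) (fst x) (snd x) = 0).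
Proof.
intros hk hg hnd hrho.
destruct (nullcline_small k rho hk hg hrho) as [r [r0 hr]].
set (o := ((0, 0) : R * R)).
assert (so : small r o) by (split; simpl; rewrite Rabs_R0; exact r0).
set (G p s := growth2 k (fst p) (snd p) s (nullcline k p s)).
(* The slope of [G o] at 0. Multiplying [G] by [L] makes it pass from negative to positive whatever
   the sign of [L], as [IVT_interv] requires. *)
set (L := theta k 0 0 / gamma k 0 0 - delta k 0 0).
assert (hL : L <> 0).
{ intros e; apply hnd; unfold L in e.
  replace (theta k 0 0) with (gamma k 0 0 * (theta k 0 0 / gamma k 0 0)) by (field; lra).
  replace (theta k 0 0 / gamma k 0 0) with (delta k 0 0) by lra; ring. }
(* The quotient [G o s / s], extended to [s = 0], where it equals [L]. *)
set (slope s := - delta k 0 0 + cS k 0 0 * s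
   + (theta k 0 0 - cN k 0 0 * s) / (gamma k 0 0 - cM k 0 0 * s)
   + cP k 0 0 * s * ((theta k 0 0 - cN k 0 0 * s) / (gamma k 0 0 - cM k 0 0 * s)) ^ 2).
assert (G0 : forall s, Rabs s < r -> G o s = s * slope s).
{ intros s hs; destruct (hr o s so hs) as [_ hn]; simpl in hn.
  unfold G, growth2, nullcline, slope; simpl; field; exact hn. }
assert (hslope : locally 0 (fun s => 0 < L * slope s)).
{ apply (lim_gt _ (L * L)); [|assert (h := Rsqr_pos_lt _ hL); exact h].
  apply lim_mult; [apply filterlim_const|].
  apply lim_eq with (slope 0).
  - assert (hs : filterlim (fun s : R => s) (locally 0) (locally 0)) by apply filterlim_id.
    unfold slope; lim; lra.
  - unfold slope, L; field; lra. }
destruct hslope as [e he].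
(* Half the minimum, to stay strictly below [r] (nullcline defined and small), [rho] (size of the
   root) and [e] (sign of [slope]). *)
set (s := Rmin (Rmin r rho) e / 2).
assert (m1 := Rmin_l (Rmin r rho) e); assert (m2 := Rmin_r (Rmin r rho) e).
assert (m3 := Rmin_l r rho); assert (m4 := Rmin_r r rho).
assert (s0 : 0 < s).
{ assert (h := Rmin_pos _ _ (Rmin_pos _ _ r0 hrho) (cond_pos e)); unfold s; lra. }
assert (sr : s < r) by (unfold s in *; lra).
assert (srho : s < rho) by (unfold s in *; lra).
assert (se : s < e) by (unfold s in *; lra).
assert (Gp : 0 < L * G o s).
{ rewrite G0 by (rewrite Rabs_pos_eq; lra).
  assert (h := he s); replace (L * (s * slope s)) with (s * (L * slope s)) by ring.
  apply Rmult_lt_0_compat; [exact s0|apply h].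
  change (Rabs (s - 0) < e); rewrite Rminus_0_r, Rabs_pos_eq; lra. }
assert (Gm : L * G o (- s) < 0).
{ rewrite G0 by (rewrite Rabs_Ropp, Rabs_pos_eq; lra).
  assert (h : 0 < L * slope (- s)).
  { apply he; change (Rabs (- s - 0) < e); rewrite Rminus_0_r, Rabs_Ropp, Rabs_pos_eq; lra. }
  nra. }
assert (Glim : forall (T : Type) (F : (T -> Prop) -> Prop) (FF : Filter F) (g : T -> R) h q a,
  coef_cont k q -> filterlim h F (locally q) -> filterlim g F (locally a) ->
  gamma k (fst q) (snd q) - cM k (fst q) (snd q) * a <> 0 ->
  filterlim (fun t => L * G (h t) (g t)) F (locally (L * G q a))).
{ intros T F FF g h q a hc hh hga hn; apply lim_mult; [apply filterlim_const|].
  apply (growth_lim k h (fun t => (g t, nullcline k (h t) (g t))) q (a, nullcline k q a) hc hh).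
  apply lim_components; split; [exact hga|apply nullcline_lim; assumption]. }
assert (rs : forall z, - s <= z <= s -> Rabs z < r) by (intros z hz; apply Rabs_def1; lra).
assert (lim0 : forall z, - s <= z <= s ->
  filterlim (fun p => L * G p z) (locally o) (locally (L * G o z))).
{ intros z hz; apply (Glim _ _ _ (fun _ => z) (fun p => p) o z hk);
    [apply filterlim_id|apply filterlim_const|].
  apply (hr o z so (rs z hz)). }
assert (a1 : locally o (fun p => 0 < L * G p s))
  by (apply (lim_gt _ (L * G o s)); [apply lim0; split; lra|exact Gp]).
assert (a2 : locally o (fun p => L * G p (- s) < 0))
  by (apply (lim_lt _ (L * G o (- s))); [apply lim0; split; lra|exact Gm]).
assert (a3 : locally o (small r)) by (apply locally_small; exists r; split; auto).
generalize (filter_and _ _ a1 (filter_and _ _ a2 a3)); apply filter_imp.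
intros p [b1 [b2 b3]].
destruct (IVT_interv (fun z => L * G p z) (- s) s) as [z [hz e0]]; try assumption; try lra.
- intros z hz; apply continuity_pt_filterlim.
  destruct (hr p z b3 (rs z hz)) as [_ hn].
  assert (hid : filterlim (fun z : R => z) (locally z) (locally z)) by apply filterlim_id.
  unfold G, growth2, nullcline; lim.
- destruct (hr p z b3 (rs z hz)) as [hn1 hn2].
  exists (z, nullcline k p z); simpl; split; [split; simpl; [apply Rabs_def1; lra|exact hn1]|].
  split; [apply growth1_nullcline, hn2|].
  destruct (Rmult_integral _ _ e0) as [h|h]; [contradiction|exact h].
Qed.

(** A small root is chosen for every parameter. Uniqueness follows from Cramer's rule: when [growth]
    vanishes at both points and [K] is invertible, the points coincide. *)
Lemma E3_exists (k : coefficients) :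
  coef_cont k (0, 0) -> gamma k 0 0 < 0 -> theta k 0 0 - gamma k 0 0 * delta k 0 0 <> 0 ->
  exists E, is_E3 k E.
Proof.
intros hk hg hnd.
destruct (secant_inverse k hk hnd) as [r [B [r0 hr]]].
assert (hs := small_roots k (r / 2) hk hg hnd ltac:(lra)).
assert (hsm : locally (0, 0) (small r)) by (apply locally_small; exists r; split; auto).
destruct (proj1 (locally_enorm _) (filter_and _ _ hs hsm)) as [eps [eps0 heps]].
(* The radius is [r / 2] because [small (r / 2)] lies inside the Euclidean ball of radius [r]. *)
exists (fun u v => epsilon (inhabits (0, 0)) (fun x => small (r / 2) x /\
  growth1 k u v (fst x) (snd x) = 0 /\ growth2 k u v (fst x) (snd x) = 0)).
exists r, eps; split; [exact r0|split; [exact eps0|]]; intros u v huv.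
destruct (heps u v huv) as [ex sm].
match goal with |- enorm (fst ?X) _ < _ /\ _ => set (x := X) end.
destruct (epsilon_spec (inhabits (0, 0)) _ ex) as [p1 [p2 p3]].
change (small (r / 2) x) in p1.
change (growth1 k u v (fst x) (snd x) = 0) in p2.
change (growth2 k u v (fst x) (snd x) = 0) in p3.
split; [destruct x; apply small_enorm, p1|split; [exact p2|split; [exact p3|]]].
intros x1 x2 hx e1 e2.
assert (sx : small r x) by (destruct p1; split; lra).
destruct (hr (u, v) (x1, x2) x sm (enorm_small _ _ _ hx) sx) as [hd _].
assert (d1 := secant_solve1 k (u, v) (x1, x2) x hd e1 e2).
assert (d2 := secant_solve2 k (u, v) (x1, x2) x hd e1 e2).
simpl fst in d1, d2; simpl snd in d1, d2; rewrite p2, p3 in d1, d2.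
rewrite (surjective_pairing x); f_equal; lra.
Qed.

(** * The equilibrium as a continuous branch *)

(** The form in which [is_E3] is used from here on: local uniqueness is traded for convergence of
    [E] to the origin. *)
Definition branch (k : coefficients) (E : R -> R -> R * R) : Prop :=
  filterlim (fun p => E (fst p) (snd p)) (locally (0, 0)) (locally (0, 0)) /\
  locally (0, 0) (fun p =>
    growth1 k (fst p) (snd p) (fst (E (fst p) (snd p))) (snd (E (fst p) (snd p))) = 0 /\
    growth2 k (fst p) (snd p) (fst (E (fst p) (snd p))) (snd (E (fst p) (snd p))) = 0).

(** [small_roots] gives a root in any prescribed neighbourhood of the origin; if that neighbourhood
    lies in the ball of uniqueness, the root must be [E]. *)
Lemma E3_branch (k : coefficients) (E : R -> R -> R * R) :
  coef_cont k (0, 0) -> gamma k 0 0 < 0 -> theta k 0 0 - gamma k 0 0 * delta k 0 0 <> 0 ->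
  is_E3 k E -> branch k E.
Proof.
intros hk hg hnd [r [eps [r0 [eps0 hE]]]]; split.
- apply filterlim_locally; intros e.
  set (rho := Rmin (r / 2) e).
  assert (rho0 : 0 < rho) by (apply Rmin_pos; [lra|apply cond_pos]).
  assert (m1 := Rmin_l (r / 2) e : rho <= r / 2); assert (m2 := Rmin_r (r / 2) e : rho <= e).
  assert (hs := small_roots k rho hk hg hnd rho0).
  assert (he : locally (0, 0) (fun p => enorm (fst p) (snd p) < eps)).
  { apply locally_enorm; exists eps; split; auto. }
  generalize (filter_and _ _ hs he); apply filter_imp; intros p [[[x1 x2] [hx [e1 e2]]] hp].
  destruct (hE _ _ hp) as [_ [_ [_ hu]]].
  destruct hx as [hx1 hx2]; simpl in hx1, hx2.
  change (ball ((0, 0) : R * R) e (E (fst p) (snd p))).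
  rewrite <- (hu x1 x2); [|apply small_enorm; split; simpl; lra|exact e1|exact e2].
  split; [change (Rabs (x1 - 0) < e)|change (Rabs (x2 - 0) < e)]; rewrite Rminus_0_r; lra.
- apply locally_enorm; exists eps; split; [exact eps0|]; intros u v huv.
  destruct (hE u v huv) as [_ [e1 [e2 _]]]; split; assumption.
Qed.

(** The filter [locally] does not puncture the origin, so the value there equals the limit. *)
Lemma branch_at0 (k : coefficients) (E : R -> R -> R * R) : branch k E -> E 0 0 = (0, 0).
Proof.
intros [h _].
assert (c := proj1 (lim_components (F := locally ((0, 0) : R * R)) _ _) h).
destruct c as [c1 c2]; simpl in c1, c2.
assert (z : forall x, (forall e, 0 < e -> Rabs (x - 0) < e) -> x = 0).
{ intros x hx; destruct (Req_dec x 0) as [e|n]; [exact e|].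
  assert (a := hx _ (Rabs_pos_lt _ n)); rewrite Rminus_0_r in a; lra. }
rewrite (surjective_pairing (E 0 0)); f_equal; apply z; intros e he.
- exact (locally_singleton _ _ (lim_close _ _ e c1 he)).
- exact (locally_singleton _ _ (lim_close _ _ e c2 he)).
Qed.

(** Cramer's rule with [x = E q] and [y = E p] bounds [E q - E p] by a constant times the size of
    [growth q (E p)], which tends to [growth p (E p) = 0] as [q] tends to [p]. *)
Lemma branch_continuous (k : coefficients) (E : R -> R -> R * R) :
  smooth_coefficients k -> theta k 0 0 - gamma k 0 0 * delta k 0 0 <> 0 -> branch k E ->
  locally (0, 0) (fun p =>
    filterlim (fun q => E (fst q) (snd q)) (locally p) (locally (E (fst p) (snd p)))).
Proof.
intros hs hnd [hE0 hE].
assert (hk := coef_cont_near0 k hs).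
destruct (secant_inverse k (locally_singleton _ _ hk) hnd) as [r [B [r0 hr]]].
assert (sm : locally (0, 0) (small r)) by (apply locally_small; exists r; split; auto).
assert (sE := hE0 _ sm).
(* [locally_locally] provides the root equations on a whole neighbourhood of [p], since they are
   applied at the moving point [q]. *)
generalize (filter_and _ _ hk (locally_locally _ _ (filter_and _ _ hE (filter_and _ _ sm sE)))).
apply filter_imp; intros p [kp hp].
destruct (locally_singleton _ _ hp) as [[e1 e2] [sp sx]].
set (x := E (fst p) (snd p)) in *.
set (g q := B * (Rabs (growth1 k (fst q) (snd q) (fst x) (snd x))
                 + Rabs (growth2 k (fst q) (snd q) (fst x) (snd x)))).
assert (hg : filterlim g (locally p) (locally 0)).
{ destruct (growth_lim k (F := locally p) (fun q => q) (fun _ => x) p x kp) as [g1 g2];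
    [apply filterlim_id|apply filterlim_const|].
  apply lim_eq with (2 := e1) in g1; apply lim_eq with (2 := e2) in g2.
  apply lim_eq with (B * (Rabs 0 + Rabs 0)); [|rewrite Rabs_R0; ring].
  apply lim_mult; [apply filterlim_const|apply lim_plus; apply lim_abs; assumption]. }
assert (bd : forall a b X Y, Rabs X <= B -> Rabs Y <= B ->
  Rabs (a * X + b * Y) <= B * (Rabs a + Rabs b)).
{ intros a b X Y hX hY; eapply Rle_trans; [apply Rabs_triang|]; rewrite !Rabs_mult.
  assert (ha := Rabs_pos a); assert (hb := Rabs_pos b); nra. }
apply lim_components; split; apply lim_squeeze with (2 := hg);
  revert hp; apply filter_imp; intros q [[q1 q2] [sq sxq]];
  destruct (hr q (E (fst q) (snd q)) x sq sxq sx) as [hd [b1 [b2 [b3 b4]]]].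
- apply (Rle_trans _ _ _ (Req_le _ _ (f_equal Rabs (secant_solve1 k q (E (fst q) (snd q)) x hd q1 q2)))).
  apply bd; [rewrite Rabs_Ropp|]; assumption.
- apply (Rle_trans _ _ _ (Req_le _ _ (f_equal Rabs (secant_solve2 k q (E (fst q) (snd q)) x hd q1 q2)))).
  apply bd; [|rewrite Rabs_Ropp]; assumption.
Qed.

(** * Differentiability of the branch in [mu2] *)

Lemma derive_lim (f : R -> R) (m d : R) :
  is_derive f m d <->
  filterlim (fun h => (f (m + h) - f m) / h) (locally' 0) (locally d).
Proof.
rewrite is_derive_Reals, (filterlim_locally (F := locally' 0)); split.
- intros hf eps; destruct (hf eps (cond_pos eps)) as [e he].
  exists e; intros h hh h0; apply he; [exact h0|].
  change (Rabs (h - 0) < e) in hh; rewrite Rminus_0_r in hh; exact hh.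
- intros hf eps eps0; destruct (hf (mkposreal eps eps0)) as [e he].
  exists e; intros h h0 hh; apply he; [|exact h0].
  change (Rabs (h - 0) < e); rewrite Rminus_0_r; exact hh.
Qed.

(** Only continuity of [u] is needed, since [f m = 0]. *)
Lemma derive_mult_vanishing (f u : R -> R) (m d : R) :
  is_derive f m d -> f m = 0 -> filterlim u (locally m) (locally (u m)) ->
  is_derive (fun t => f t * u t) m (d * u m).
Proof.
intros hf f0 hu; apply derive_lim; apply derive_lim in hf.
assert (sh : filterlim (fun h => u (m + h)) (locally' 0) (locally (u m))).
{ apply (filterlim_comp _ _ _ (fun h => m + h) u _ (locally m)); [|exact hu].
  apply lim_eq with (m + 0); [|ring].
  apply lim_plus; [apply filterlim_const|].
  apply filterlim_filter_le_1 with (2 := filterlim_id _ (locally 0)); apply filter_le_within. }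
apply filterlim_ext with (2 := lim_mult _ _ _ _ hf sh).
intros h; rewrite f0; unfold Rdiv; ring.
Qed.

(** The shape of Cramer's rule solved for a coordinate of [E]: [f] and [g] are the growth rates at a
    frozen point, [u] and [v] entries of the inverse of [K] up to sign, known only to be
    continuous. *)
Lemma derive_vanishing_combination (c : R) (f u g v : R -> R) (m df dg : R) :
  is_derive f m df -> f m = 0 -> filterlim u (locally m) (locally (u m)) ->
  is_derive g m dg -> g m = 0 -> filterlim v (locally m) (locally (v m)) ->
  is_derive (fun t => c + (f t * u t + g t * v t)) m (df * u m + dg * v m).
Proof.
intros hf f0 hu hg g0 hv.
assert (h1 := derive_mult_vanishing f u m df hf f0 hu).
assert (h2 := derive_mult_vanishing g v m dg hg g0 hv).
assert (h := is_derive_plus _ _ _ _ _ (is_derive_const c m) (is_derive_plus _ _ _ _ _ h1 h2)).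
rewrite plus_zero_l in h; exact h.
Qed.

Definition coef_derive (k : coefficients) (p : R * R) : Prop :=
  is_derive (fun m => theta k (fst p) m) (snd p) (D2 (theta k) p) /\
  is_derive (fun m => gamma k (fst p) m) (snd p) (D2 (gamma k) p) /\
  is_derive (fun m => delta k (fst p) m) (snd p) (D2 (delta k) p) /\
  is_derive (fun m => cM k (fst p) m) (snd p) (D2 (cM k) p) /\
  is_derive (fun m => cN k (fst p) m) (snd p) (D2 (cN k) p) /\
  is_derive (fun m => cS k (fst p) m) (snd p) (D2 (cS k) p) /\
  is_derive (fun m => cP k (fst p) m) (snd p) (D2 (cP k) p).

Lemma coef_derive_near0 (k : coefficients) :
  smooth_coefficients k -> locally (0, 0) (coef_derive k).
Proof.
intros [h1 [h2 [h3 [h4 [h5 [h6 h7]]]]]].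
repeat (apply filter_and; [apply smooth_D2; assumption|]); apply smooth_D2; assumption.
Qed.

Definition dgrowth1 (k : coefficients) (p x : R * R) : R :=
  - D2 (theta k) p * fst x + D2 (gamma k) p * snd x
  - D2 (cM k) p * fst x * snd x + D2 (cN k) p * fst x ^ 2.
Definition dgrowth2 (k : coefficients) (p x : R * R) : R :=
  1 - D2 (delta k) p * fst x + D2 (cS k) p * fst x ^ 2 + D2 (cP k) p * snd x ^ 2.

Lemma growth_derive (k : coefficients) (p x : R * R) : coef_derive k p ->
  is_derive (fun m => growth1 k (fst p) m (fst x) (snd x)) (snd p) (dgrowth1 k p x) /\
  is_derive (fun m => growth2 k (fst p) m (fst x) (snd x)) (snd p) (dgrowth2 k p x).
Proof.
intros [h1 [h2 [h3 [h4 [h5 [h6 h7]]]]]].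
unfold growth1, growth2; split; auto_derive.
1, 3: repeat split; eexists; eassumption.
all: unfold dgrowth1, dgrowth2, D2; ring.
Qed.

(** With [dE2], the vector [- K^-1 (dgrowth1, dgrowth2)] of implicit differentiation, [K] being
    taken on the diagonal. *)
Definition dE1 (k : coefficients) (p x : R * R) : R :=
  dgrowth1 k p x * - (sec22 k p x x / secdet k p x x)
  + dgrowth2 k p x * (sec12 k p x / secdet k p x x).
Definition dE2 (k : coefficients) (p x : R * R) : R :=
  dgrowth1 k p x * (sec21 k p x x / secdet k p x x)
  + dgrowth2 k p x * - (sec11 k p x x / secdet k p x x).

Lemma line_lim (p : R * R) : filterlim (fun m => (fst p, m)) (locally (snd p)) (locally p).
Proof.
apply lim_components; split; simpl; [apply filterlim_const|apply filterlim_id].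
Qed.

(** Cramer's rule with [x = E a m] and [y = E a b] is an exact formula for [E a m]. Its growth
    factors are differentiable and vanish at [m = b], and its other factors are continuous because
    [E] is. *)
Lemma branch_derive (k : coefficients) (E : R -> R -> R * R) :
  smooth_coefficients k -> theta k 0 0 - gamma k 0 0 * delta k 0 0 <> 0 -> branch k E ->
  locally (0, 0) (fun p =>
    is_derive (fun m => fst (E (fst p) m)) (snd p) (dE1 k p (E (fst p) (snd p))) /\
    is_derive (fun m => snd (E (fst p) m)) (snd p) (dE2 k p (E (fst p) (snd p)))).
Proof.
intros hs hnd hb.
assert (hc := branch_continuous k E hs hnd hb); destruct hb as [hE0 hE].
assert (hk := coef_cont_near0 k hs); assert (hd := coef_derive_near0 k hs).
destruct (secant_inverse k (locally_singleton _ _ hk) hnd) as [r [B [r0 hr]]].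
assert (sm : locally (0, 0) (small r)) by (apply locally_small; exists r; split; auto).
assert (sE := hE0 _ sm).
generalize (filter_and _ _ (filter_and _ _ hk (filter_and _ _ hd hc))
  (locally_locally _ _ (filter_and _ _ hE (filter_and _ _ sm sE)))).
apply filter_imp; intros [a b] [[kp [dp cp]] hp].
destruct (locally_singleton _ _ hp) as [[e1 e2] [sp sx]].
(* Restricts a neighbourhood of [(a, b)] in the plane to the line [mu1 = a]. *)
assert (hline := line_lim (a, b) _ hp); unfold filtermap in hline; cbn [fst snd] in hline.
set (x := E a b) in *.
destruct (growth_derive k (a, b) x dp) as [dg1 dg2].
assert (cE : filterlim (fun m => E a m) (locally b) (locally x)).
{ exact (filterlim_comp _ _ _ _ _ _ _ _ (line_lim (a, b)) cp). }
destruct (secant_lim k (F := locally b) (fun m => (a, m)) (fun m => E a m) (fun _ => x) (a, b) x x kp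
  (line_lim (a, b)) cE (filterlim_const x)) as [l11 [l12 [l21 [l22 ldet]]]].
destruct (hr (a, b) x x sp sx sx) as [hdet _].
cbn [fst snd] in dg1, dg2, e1, e2, l11, l12, l21, l22, ldet |- *.
split.
- apply is_derive_ext_loc with (fun m => fst x +
    (growth1 k a m (fst x) (snd x)
      * - (sec22 k (a, m) (E a m) x / secdet k (a, m) (E a m) x)
     + growth2 k a m (fst x) (snd x)
      * (sec12 k (a, m) x / secdet k (a, m) (E a m) x))).
  + revert hline; apply filter_imp; intros m [[q1 q2] [sq sxq]]; simpl in q1, q2, sxq.
    destruct (hr (a, m) (E a m) x sq sxq sx) as [hdm _].
    assert (h := secant_solve1 k (a, m) (E a m) x hdm q1 q2); simpl in h |- *; lra.
  + apply (derive_vanishing_combination (fst x) (fun m => growth1 k a m (fst x) (snd x))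
      (fun m => - (sec22 k (a, m) (E a m) x / secdet k (a, m) (E a m) x))
      (fun m => growth2 k a m (fst x) (snd x))
      (fun m => sec12 k (a, m) x / secdet k (a, m) (E a m) x)); try assumption; lim.
- apply is_derive_ext_loc with (fun m => snd x +
    (growth1 k a m (fst x) (snd x)
      * (sec21 k (a, m) (E a m) x / secdet k (a, m) (E a m) x)
     + growth2 k a m (fst x) (snd x)
      * - (sec11 k (a, m) (E a m) x / secdet k (a, m) (E a m) x))).
  + revert hline; apply filter_imp; intros m [[q1 q2] [sq sxq]]; simpl in q1, q2, sxq.
    destruct (hr (a, m) (E a m) x sq sxq sx) as [hdm _].
    assert (h := secant_solve2 k (a, m) (E a m) x hdm q1 q2); simpl in h |- *; lra.
  + apply (derive_vanishing_combination (snd x) (fun m => growth1 k a m (fst x) (snd x))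
      (fun m => sec21 k (a, m) (E a m) x / secdet k (a, m) (E a m) x)
      (fun m => growth2 k a m (fst x) (snd x))
      (fun m => - (sec11 k (a, m) (E a m) x / secdet k (a, m) (E a m) x))); try assumption; lim.
Qed.

(** * Trace and determinant at the equilibrium *)

(** The trace of the Jacobian at a root: the product rule leaves only these terms when both growth
    rates vanish. *)
Definition tr (k : coefficients) (p x : R * R) : R :=
  fst x * sec11 k p x x + snd x * sec22 k p x x.

Lemma jacobian_root (k : coefficients) (p x : R * R) :
  growth1 k (fst p) (snd p) (fst x) (snd x) = 0 ->
  growth2 k (fst p) (snd p) (fst x) (snd x) = 0 ->
  jacobian k (fst p) (snd p) x =
  Mat2 (fst x * sec11 k p x x) (fst x * sec12 k p x)
       (snd x * sec21 k p x x) (snd x * sec22 k p x x).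
Proof.
intros h1 h2; unfold jacobian; f_equal; apply is_derive_unique; unfold field1, field2, growth1, growth2;
  auto_derive; trivial; unfold growth1, growth2, sec11, sec12, sec21, sec22 in *; lra.
Qed.

Lemma eig_p_root (k : coefficients) (p x : R * R) :
  growth1 k (fst p) (snd p) (fst x) (snd x) = 0 ->
  growth2 k (fst p) (snd p) (fst x) (snd x) = 0 ->
  eig_p (jacobian k (fst p) (snd p) x) = tr k p x / 2.
Proof. intros h1 h2; rewrite jacobian_root by assumption; reflexivity. Qed.

(** The determinant of the Jacobian is [x1 x2] times [secdet], so in the open quadrant both have the
    same sign. *)
Lemma imaginary_pair_root (k : coefficients) (p x : R * R) :
  growth1 k (fst p) (snd p) (fst x) (snd x) = 0 ->
  growth2 k (fst p) (snd p) (fst x) (snd x) = 0 ->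
  0 < fst x -> 0 < snd x ->
  imaginary_pair (jacobian k (fst p) (snd p) x) <-> tr k p x = 0 /\ 0 < secdet k p x x.
Proof.
intros h1 h2 p1 p2.
rewrite imaginary_pairE; unfold eig_q; rewrite eig_p_root, jacobian_root by assumption; simpl.
assert (pos : 0 < fst x * snd x) by (apply Rmult_lt_0_compat; assumption).
assert (ed : fst x * sec11 k p x x * (snd x * sec22 k p x x)
   - fst x * sec12 k p x * (snd x * sec21 k p x x) = fst x * snd x * secdet k p x x)
  by (unfold secdet; ring).
rewrite ed; split; intros [e0 hq].
- assert (et : tr k p x = 0) by lra; split; [exact et|].
  rewrite et in hq; apply (Rmult_lt_reg_l (fst x * snd x)); [exact pos|].
  unfold Rdiv in hq; rewrite !Rmult_0_l in hq; lra.
- rewrite e0; split; [lra|].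
  assert (h := Rmult_lt_0_compat _ _ pos hq); unfold Rdiv; rewrite !Rmult_0_l; lra.
Qed.

(** The total [mu2]-derivative of [tr] along a curve passing through [x] with velocity [d]. *)
Definition dtr (k : coefficients) (p x d : R * R) : R :=
  fst d * sec11 k p x x
  + fst x * (- D2 (theta k) p - D2 (cM k) p * snd x - cM k (fst p) (snd p) * snd d
             + D2 (cN k) p * (fst x + fst x) + cN k (fst p) (snd p) * (fst d + fst d))
  + snd d * sec22 k p x x
  + snd x * (D2 (cP k) p * (snd x + snd x) + cP k (fst p) (snd p) * (snd d + snd d)).

Lemma tr_derive (k : coefficients) (p : R * R) (X Y : R -> R) (d : R * R) :
  coef_derive k p -> is_derive X (snd p) (fst d) -> is_derive Y (snd p) (snd d) ->
  is_derive (fun m => tr k (fst p, m) (X m, Y m)) (snd p)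
    (dtr k p (X (snd p), Y (snd p)) d).
Proof.
intros [h1 [_ [_ [h4 [h5 [_ h7]]]]]] hX hY.
unfold tr, sec11, sec22; simpl; auto_derive.
- repeat split; eexists; eassumption.
- unfold dtr, sec11, sec22, D2; simpl.
  replace (Derive (fun x : R => X x) (snd p)) with (fst d)
    by (symmetry; apply is_derive_unique, hX).
  replace (Derive (fun x : R => Y x) (snd p)) with (snd d)
    by (symmetry; apply is_derive_unique, hY).
  ring.
Qed.

Lemma tr_lim (k : coefficients) {T : Type} {F : (T -> Prop) -> Prop} {FF : Filter F}
    (g x : T -> R * R) (p a : R * R) :
  coef_cont k p -> filterlim g F (locally p) -> filterlim x F (locally a) ->
  filterlim (fun t => tr k (g t) (x t)) F (locally (tr k p a)).
Proof.
intros hk hg hx.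
destruct (secant_lim k g x x p a a hk hg hx hx) as [h1 [_ [_ [h4 _]]]].
apply lim_components in hx; destruct hx as [hx1 hx2].
unfold tr; lim.
Qed.

(** Terms with a factor [x] vanish in the limit, leaving [- theta * dE1 + dE2]. There [dgrowth1]
    tends to 0 and [dgrowth2] to 1, so [dE1] and [dE2] tend to [gamma] and [theta] divided by
    [gamma delta - theta]. *)
Lemma dtr_branch_lim (k : coefficients) (E : R -> R -> R * R) :
  smooth_coefficients k -> theta k 0 0 - gamma k 0 0 * delta k 0 0 <> 0 -> branch k E ->
  filterlim (fun p : R * R => dtr k p (E (fst p) (snd p))
      (dE1 k p (E (fst p) (snd p)), dE2 k p (E (fst p) (snd p))))
    (locally (0, 0))
    (locally (theta k 0 0 * (1 - gamma k 0 0) / (gamma k 0 0 * delta k 0 0 - theta k 0 0))).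
Proof.
intros hs hnd [hE _].
assert (hk := locally_singleton _ _ (coef_cont_near0 k hs)).
assert (hid : filterlim (fun p : R * R => p) (locally (0, 0)) (locally ((0, 0) : R * R)))
  by apply filterlim_id.
destruct (secant_lim k (F := locally ((0, 0) : R * R)) _ _ _ _ _ _ hk hid hE hE)
  as [l11 [l12 [l21 [l22 ldet]]]].
destruct (coef_lim k (F := locally ((0, 0) : R * R)) _ _ hk hid)
  as [a1 [a2 [a3 [a4 [a5 [a6 a7]]]]]].
destruct hs as [s1 [s2 [s3 [s4 [s5 [s6 s7]]]]]].
assert (b1 := proj2 (smooth_D2 _ s1)); assert (b2 := proj2 (smooth_D2 _ s2)).
assert (b3 := proj2 (smooth_D2 _ s3)); assert (b4 := proj2 (smooth_D2 _ s4)).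
assert (b5 := proj2 (smooth_D2 _ s5)); assert (b6 := proj2 (smooth_D2 _ s6)).
assert (b7 := proj2 (smooth_D2 _ s7)).
apply (lim_components (F := locally ((0, 0) : R * R))) in hE; destruct hE as [e1 e2].
assert (hd : secdet k (0, 0) (0, 0) (0, 0) <> 0) by (rewrite secdet_at0; lra).
eapply lim_eq.
- unfold dtr; simpl fst; simpl snd; unfold dE1, dE2, dgrowth1, dgrowth2; lim.
- rewrite secdet_at0; unfold sec11, sec12, sec21, sec22; simpl; field; lra.
Qed.

(** * Implicit functions by monotonicity *)

(** Strict increase in [v] and opposite signs at [v = - eta] and [v = eta] give exactly one zero.
    For continuity of [h], the signs of [f] just above and just below [h u] persist for [t] near [u]
    and trap [h t]. *)
Lemma monotone_implicit (f d : R -> R -> R) (a eta : R) :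
  0 < eta -> eta < a -> f 0 0 = 0 ->
  (forall u v, Rabs u < a -> Rabs v < a ->
    filterlim (fun t => f t v) (locally u) (locally (f u v))) ->
  (forall u v, Rabs u < a -> Rabs v < a -> is_derive (fun t => f u t) v (d u v) /\ 0 < d u v) ->
  exists b h, 0 < b /\ b <= a /\ forall u, Rabs u < b ->
    Rabs (h u) <= eta /\ f u (h u) = 0 /\ filterlim h (locally u) (locally (h u)) /\
    forall v, Rabs v < a -> f u v = 0 -> v = h u.
Proof.
intros eta0 etaa f0 fc fd.
assert (a0 : Rabs 0 < a) by (rewrite Rabs_R0; lra).
assert (mono : forall u v w, Rabs u < a -> - a < v -> v < w -> w < a -> f u v < f u w).
{ intros u v w hu hv hvw hw.
  apply (incr_function (fun t => f u t) (- a) a (d u)); simpl; try assumption;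
    intros x h1 h2; apply fd; try assumption; apply Rabs_def1; lra. }
assert (ep : Rabs eta < a) by (rewrite Rabs_pos_eq; lra).
assert (em : Rabs (- eta) < a) by (rewrite Rabs_Ropp; exact ep).
assert (hp : locally 0 (fun t => 0 < f t eta)).
{ apply (lim_gt _ (f 0 eta)); [apply fc; assumption|].
  assert (c := mono 0 0 eta a0 ltac:(lra) eta0 etaa); lra. }
assert (hm : locally 0 (fun t => f t (- eta) < 0)).
{ apply (lim_lt _ (f 0 (- eta))); [apply fc; assumption|].
  assert (c := mono 0 (- eta) 0 a0 ltac:(lra) ltac:(lra) ltac:(lra)); lra. }
destruct (filter_and _ _ hp hm) as [e he].
set (b := Rmin e a).
assert (m1 := Rmin_l e a : b <= e); assert (m2 := Rmin_r e a : b <= a).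
assert (b0 : 0 < b) by (apply Rmin_pos; [apply cond_pos|lra]).
assert (root : forall u, Rabs u < b -> exists z, - eta <= z <= eta /\ f u z = 0).
{ intros u hu; destruct (he u) as [h1 h2].
  { change (Rabs (u - 0) < e); rewrite Rminus_0_r; lra. }
  destruct (IVT_interv (fun t => f u t) (- eta) eta) as [z hz]; try assumption; try lra.
  - intros z hz; apply derivable_continuous_pt; exists (d u z); apply is_derive_Reals.
    apply fd; [lra|apply Rabs_def1; lra].
  - exists z; exact hz. }
set (h u := epsilon (inhabits 0) (fun z => - eta <= z <= eta /\ f u z = 0)).
assert (hspec : forall u, Rabs u < b -> - eta <= h u <= eta /\ f u (h u) = 0)
  by (intros u hu; exact (epsilon_spec (inhabits 0) _ (root u hu))).
exists b, h; split; [exact b0|split; [exact m2|]]; intros u hu.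
destruct (hspec u hu) as [h1 h2].
split; [apply Rabs_le; exact h1|split; [exact h2|split]].
2: { intros v hv fv; apply Rabs_def2 in hv.
  destruct (Rtotal_order v (h u)) as [l|[l|l]]; [|exact l|].
  - assert (c := mono u v (h u) ltac:(lra) ltac:(lra) l ltac:(lra)); lra.
  - assert (c := mono u (h u) v ltac:(lra) ltac:(lra) l ltac:(lra)); lra. }
apply filterlim_locally; intros eps.
(* Since [h u] is at most [eta] in absolute value, a step below [a - eta] keeps [h u + e'] and
   [h u - e'] where [f] is monotone. *)
set (e' := Rmin eps (a - eta) / 2).
assert (n1 := Rmin_l eps (a - eta)); assert (n2 := Rmin_r eps (a - eta)).
assert (e'0 : 0 < Rmin eps (a - eta)) by (apply Rmin_pos; [apply cond_pos|lra]).
assert (ua : Rabs u < a) by lra.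
assert (qp : locally u (fun t => 0 < f t (h u + e'))).
{ apply (lim_gt _ (f u (h u + e'))).
  - apply fc; [exact ua|apply Rabs_def1; unfold e'; lra].
  - assert (c := mono u (h u) (h u + e') ua ltac:(lra) ltac:(unfold e'; lra) ltac:(unfold e'; lra)); lra. }
assert (qm : locally u (fun t => f t (h u - e') < 0)).
{ apply (lim_lt _ (f u (h u - e'))).
  - apply fc; [exact ua|apply Rabs_def1; unfold e'; lra].
  - assert (c := mono u (h u - e') (h u) ua ltac:(unfold e'; lra) ltac:(unfold e'; lra) ltac:(lra)); lra. }
assert (qb : locally u (fun t => Rabs t < b)).
{ apply (lim_lt _ (Rabs u)); [apply lim_abs, filterlim_id|exact hu]. }
generalize (filter_and _ _ qp (filter_and _ _ qm qb)); apply filter_imp.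
intros t [k1 [k2 k3]]; destruct (hspec t k3) as [h3 h4].
assert (ta : Rabs t < a) by lra.
change (Rabs (h t - h u) < eps).
assert (u1 : h t < h u + e').
{ destruct (Rlt_le_dec (h t) (h u + e')) as [l|[l|l]]; [exact l| |rewrite l in k1; lra].
  assert (c := mono t (h u + e') (h t) ta ltac:(unfold e'; lra) l ltac:(lra)); lra. }
assert (u2 : h u - e' < h t).
{ destruct (Rlt_le_dec (h u - e') (h t)) as [l|[l|l]]; [exact l| |rewrite <- l in k2; lra].
  assert (c := mono t (h t) (h u - e') ta ltac:(lra) l ltac:(unfold e'; lra)); lra. }
apply Rabs_def1; unfold e' in *; lra.
Qed.

(** * The two cases of the theorem *)

(** If [theta < 0], both diagonal entries of [K] are positive near the origin, and so is the trace
    in the quadrant. If [gamma delta < theta], the determinant is negative there. *)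
Lemma branch_no_Hopf (k : coefficients) (E : R -> R -> R * R) :
  smooth_coefficients k -> branch k E ->
  theta k 0 0 < 0 \/ gamma k 0 0 * delta k 0 0 < theta k 0 0 ->
  no_Hopf k E.
Proof.
intros hs [hE hroot] hcase.
assert (hk := locally_singleton _ _ (coef_cont_near0 k hs)).
assert (hid : filterlim (fun p : R * R => p) (locally (0, 0)) (locally ((0, 0) : R * R)))
  by apply filterlim_id.
destruct (secant_lim k (F := locally ((0, 0) : R * R)) _ _ _ _ _ _ hk hid hE hE)
  as [l11 [_ [_ [l22 ldet]]]].
rewrite secdet_at0 in ldet.
assert (v11 : sec11 k (0, 0) (0, 0) (0, 0) = - theta k 0 0) by (unfold sec11; simpl; ring).
assert (v22 : sec22 k (0, 0) (0, 0) (0, 0) = 1) by (unfold sec22; simpl; ring).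
assert (key : locally (0, 0) (fun p : R * R =>
  (0 < sec11 k p (E (fst p) (snd p)) (E (fst p) (snd p)) /\
   0 < sec22 k p (E (fst p) (snd p)) (E (fst p) (snd p))) \/
  secdet k p (E (fst p) (snd p)) (E (fst p) (snd p)) < 0)).
{ destruct hcase as [h|h].
  - assert (a1 := lim_gt (F := locally ((0, 0) : R * R)) _ _ 0 l11 ltac:(lra)).
    assert (a2 := lim_gt (F := locally ((0, 0) : R * R)) _ _ 0 l22 ltac:(lra)).
    generalize (filter_and _ _ a1 a2); apply filter_imp; intros p hp; left; exact hp.
  - assert (a1 := lim_lt (F := locally ((0, 0) : R * R)) _ _ 0 ldet ltac:(lra)).
    revert a1; apply filter_imp; intros p hp; right; exact hp. }
destruct (proj1 (locally_enorm _) (filter_and _ _ key hroot)) as [eps [eps0 heps]].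
exists eps; split; [exact eps0|]; intros u v huv [p1 p2] him.
destruct (heps u v huv) as [hkey [e1 e2]]; simpl in hkey, e1, e2.
unfold jacobian_at in him.
apply (imaginary_pair_root k (u, v) (E u v) e1 e2 p1 p2) in him; destruct him as [t0 d0].
destruct hkey as [[h1 h2]|h]; [|lra].
unfold tr in t0.
assert (c1 := Rmult_lt_0_compat _ _ p1 h1); assert (c2 := Rmult_lt_0_compat _ _ p2 h2); lra.
Qed.

(** The curve is the part over small [mu1 > 0] of the graph [mu2 = h mu1] on which the trace
    vanishes. *)
Lemma branch_Hopf (k : coefficients) (E : R -> R -> R * R) :
  smooth_coefficients k -> gamma k 0 0 < 0 -> branch k E ->
  0 < theta k 0 0 -> theta k 0 0 < gamma k 0 0 * delta k 0 0 ->
  Hopf_bifurcation k E.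
Proof.
intros hs hg hb ht htd eps eps0.
assert (hnd : theta k 0 0 - gamma k 0 0 * delta k 0 0 <> 0) by lra.
assert (hk := coef_cont_near0 k hs); assert (hk0 := locally_singleton _ _ hk).
assert (E0 := branch_at0 k E hb).
assert (cE := branch_continuous k E hs hnd hb).
assert (dE := branch_derive k E hs hnd hb).
assert (hd := coef_derive_near0 k hs).
assert (ldtr := dtr_branch_lim k E hs hnd hb).
destruct hb as [hE hroot].
assert (hid : filterlim (fun p : R * R => p) (locally (0, 0)) (locally ((0, 0) : R * R)))
  by apply filterlim_id.
destruct (secant_lim k (F := locally ((0, 0) : R * R)) _ _ _ _ _ _ hk0 hid hE hE)
  as [l11 [_ [_ [l22 ldet]]]].
rewrite secdet_at0 in ldet.
(* [sec11] between [E] and the origin, for rewriting [growth1 = 0] as a formula for [mu1] in [g1]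
   below. *)
destruct (secant_lim k (F := locally ((0, 0) : R * R)) _ _ _ _ _ _ hk0 hid hE
  (filterlim_const ((0, 0) : R * R))) as [l11' _].
destruct (coef_lim k (F := locally ((0, 0) : R * R)) _ _ hk0 hid) as [_ [lg _]].
assert (v11 : sec11 k (0, 0) (0, 0) (0, 0) = - theta k 0 0) by (unfold sec11; simpl; ring).
assert (v22 : sec22 k (0, 0) (0, 0) (0, 0) = 1) by (unfold sec22; simpl; ring).
assert (s11 := lim_lt (F := locally ((0, 0) : R * R)) _ _ 0 l11 ltac:(lra)).
assert (s11' := lim_lt (F := locally ((0, 0) : R * R)) _ _ 0 l11' ltac:(lra)).
assert (s22 := lim_gt (F := locally ((0, 0) : R * R)) _ _ 0 l22 ltac:(lra)).
assert (sdet := lim_gt (F := locally ((0, 0) : R * R)) _ _ 0 ldet ltac:(lra)).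
assert (sg := lim_lt (F := locally ((0, 0) : R * R)) _ _ 0 lg hg).
assert (Lpos : 0 < theta k 0 0 * (1 - gamma k 0 0) / (gamma k 0 0 * delta k 0 0 - theta k 0 0)).
{ apply Rdiv_lt_0_compat; [apply Rmult_lt_0_compat; lra|lra]. }
assert (sdtr := lim_gt (F := locally ((0, 0) : R * R)) _ _ 0 ldtr Lpos).
set (T u v := tr k (u, v) (E u v)).
set (dT u v := dtr k (u, v) (E u v) (dE1 k (u, v) (E u v), dE2 k (u, v) (E u v))).
assert (all := filter_and _ _ (filter_and _ _ hk (filter_and _ _ cE (filter_and _ _ dE
  (filter_and _ _ hd (filter_and _ _ sdtr (locally_locally _ _ hroot))))))
  (filter_and _ _ s11 (filter_and _ _ s11' (filter_and _ _ s22 (filter_and _ _ sdet sg))))).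
destruct (proj1 (locally_small _) all) as [r [r0 hr]]; clear all.
assert (Tc : forall u v, Rabs u < r -> Rabs v < r ->
  filterlim (fun t => T t v) (locally u) (locally (T u v))).
{ intros u v hu hv; destruct (hr (u, v) (conj hu hv)) as [[c1 [c2 _]] _].
  assert (line : filterlim (fun t => (t, v)) (locally u) (locally ((u, v) : R * R)))
    by (apply lim_components; split; simpl; [apply filterlim_id|apply filterlim_const]).
  apply (tr_lim k (fun t => (t, v)) (fun t => E t v)); [exact c1|exact line|].
  exact (filterlim_comp _ _ _ _ _ _ _ _ line c2). }
assert (Td : forall u v, Rabs u < r -> Rabs v < r ->
  is_derive (fun t => T u t) v (dT u v) /\ 0 < dT u v).
{ intros u v hu hv; destruct (hr (u, v) (conj hu hv)) as [[_ [_ [[c1 c2] [c3 [c4 _]]]]] _].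
  split; [|exact c4].
  assert (h := tr_derive k (u, v) _ _ (dE1 k (u, v) (E u v), dE2 k (u, v) (E u v)) c3 c1 c2).
  cbn [fst snd] in h; rewrite <- surjective_pairing in h.
  apply is_derive_ext with (2 := h).
  intros t; unfold T; rewrite (surjective_pairing (E u t)) at 3; reflexivity. }
assert (T0 : T 0 0 = 0) by (unfold T, tr; rewrite E0; simpl; ring).
(* A quarter of the minimum keeps [eta] below both [r] and [eps / 2], the latter for
   [small_enorm]. *)
set (eta := Rmin r eps / 4).
assert (m1 := Rmin_l r eps); assert (m2 := Rmin_r r eps).
assert (m0 := Rmin_pos r eps r0 eps0).
destruct (monotone_implicit T dT r eta ltac:(unfold eta; lra) ltac:(unfold eta; lra) T0 Tc Td)
  as [b [h [b0 [br hh]]]].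
set (b' := Rmin b eta).
assert (n1 := Rmin_l b eta : b' <= b); assert (n2 := Rmin_r b eta : b' <= eta).
assert (b'0 : 0 < b') by (apply Rmin_pos; [exact b0|unfold eta; lra]).
(* The value [t = 0] is included: the arc is open, but continuity at 0 puts the origin in its
   closure. *)
assert (dom : forall t, 0 <= t < 1 -> 0 <= b' * t < b') by (intros t ht'; nra).
assert (hdom : forall t, 0 <= t < 1 -> Rabs (b' * t) < b /\ Rabs (b' * t) < eta).
{ intros t ht'; assert (q := dom t ht'); rewrite Rabs_pos_eq; lra. }
assert (cc : forall t, 0 <= t < 1 ->
  filterlim (fun s => (b' * s, h (b' * s))) (locally t) (locally (b' * t, h (b' * t)))).
{ intros t ht'.
  assert (lt : filterlim (fun s => b' * s) (locally t) (locally (b' * t)))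
    by (apply lim_mult; [apply filterlim_const|apply filterlim_id]).
  apply lim_components; split; simpl; [exact lt|].
  apply (filterlim_comp _ _ _ (fun s => b' * s) h _ _ _ lt).
  apply hh, hdom, ht'. }
exists (fun t => (b' * t, h (b' * t))); split; [split|split].
- intros t ht'; apply cc; lra.
- intros s t hs' ht' e; injection e as e _.
  apply (Rmult_eq_reg_l b'); lra.
- intros e e0.
  (* The trace vanishes at the origin, so uniqueness of its zero identifies [h 0]. *)
  assert (h0 : h 0 = 0).
  { symmetry; apply (hh 0); [|rewrite Rabs_R0; exact r0|exact T0].
    rewrite Rabs_R0; exact b0. }
  assert (l0 := cc 0 ltac:(lra)); rewrite Rmult_0_r, h0 in l0.
  assert (sm : locally ((0, 0) : R * R) (fun p => enorm (fst p) (snd p) < e)).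
  { apply locally_enorm; exists e; split; auto. }
  destruct (l0 _ sm) as [d hd'].
  exists (Rmin (1 / 2) (d / 2)).
  assert (w1 := Rmin_l (1 / 2) (d / 2)); assert (w2 := Rmin_r (1 / 2) (d / 2)).
  assert (dp := cond_pos d).
  assert (w0 : 0 < Rmin (1 / 2) (d / 2)) by (apply Rmin_pos; lra).
  split; [lra|].
  apply hd'; change (Rabs (Rmin (1 / 2) (d / 2) - 0) < d).
  rewrite Rminus_0_r, Rabs_pos_eq; lra.
- intros t ht'; cbn [fst snd].
  set (u := b' * t); set (v := h u).
  destruct (hdom t ltac:(lra)) as [ub ue]; fold u in ub, ue.
  assert (u0 : 0 < u) by (apply Rmult_lt_0_compat; lra).
  destruct (hh u ub) as [hv [tv _]]; fold v in hv, tv.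
  assert (hv' : Rabs v < r) by (unfold eta in hv; lra).
  assert (hu' : Rabs u < r) by lra.
  split; [apply small_enorm; split; simpl; unfold eta in *; lra|].
  destruct (Td u v hu' hv') as [td1 td2].
  destruct (hr (u, v) (conj hu' hv')) as [[_ [_ [_ [_ [_ rts]]]]] [t1 [t2 [t3 [t4 t5]]]]].
  destruct (locally_singleton _ _ rts) as [e1 e2].
  cbn [fst snd] in e1, e2, t1, t2, t3, t4, t5.
  assert (tz := tv); unfold T, tr in tz.
  assert (g1 : u = fst (E u v) * - sec11 k (u, v) (E u v) (0, 0) - gamma k u v * snd (E u v)).
  { unfold growth1 in e1; unfold sec11; simpl; lra. }
  (* Zero trace with [sec11 < 0 < sec22] forces both coordinates of [E] to have the same sign. Were
     [fst (E u v) <= 0], both terms of [g1] would be nonpositive, against [0 < u]. *)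
  assert (x1 : 0 < fst (E u v)).
  { destruct (Rlt_le_dec 0 (fst (E u v))) as [l|l]; [exact l|exfalso].
    assert (snd (E u v) <= 0) by nra. nra. }
  assert (x2 : 0 < snd (E u v)) by nra.
  split; [split; assumption|split].
  + apply (imaginary_pair_root k (u, v) (E u v) e1 e2 x1 x2); split; [exact tv|exact t4].
  + exists (dT u v / 2); split; [|lra].
    (* [eig_p] is half of [T] only where [E] is a root, hence the local form of extensionality. *)
    apply is_derive_ext_loc with (fun m => T u m / 2).
    * assert (hline := line_lim (u, v) _ rts); unfold filtermap in hline; cbn [fst snd] in hline.
      revert hline; apply filter_imp; intros m [f1 f2].
      symmetry; exact (eig_p_root k (u, m) (E u m) f1 f2).
    * unfold Rdiv; rewrite Rmult_comm.
      apply is_derive_ext with (fun m => / 2 * T u m); [intros m; apply Rmult_comm|].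
      apply (is_derive_scal (T u) v (/ 2) (dT u v)); exact td1.
Qed.

Theorem theorem2p13 (k : coefficients)
  (hsmooth : smooth_coefficients k)
  (hgamma : gamma k 0 0 < 0)
  (hthetadelta : theta k 0 0 * delta k 0 0 <> 0)
  (hnondeg : theta k 0 0 - gamma k 0 0 * delta k 0 0 <> 0) :
  (exists E : R -> R -> R * R, is_E3 k E) /\
  forall E : R -> R -> R * R, is_E3 k E ->
    ((theta k 0 0 < 0 \/
      (0 < gamma k 0 0 * delta k 0 0 /\ gamma k 0 0 * delta k 0 0 < theta k 0 0) \/
      (gamma k 0 0 * delta k 0 0 < 0 /\ 0 < theta k 0 0)) ->
     no_Hopf k E) /\
    ((0 < theta k 0 0 /\ theta k 0 0 < gamma k 0 0 * delta k 0 0) ->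
     Hopf_bifurcation k E).
Proof.
assert (hk := locally_singleton _ _ (coef_cont_near0 k hsmooth)).
split; [apply E3_exists; assumption|].
intros E hE; assert (hb := E3_branch k E hk hgamma hnondeg hE); split.
- intros hcase; apply branch_no_Hopf; [assumption|assumption|].
  (* Either of the last two alternatives contains [gamma delta < theta]. *)
  destruct hcase as [h|[h|h]]; [left; exact h|right; lra|right; lra].
- intros [h1 h2]; apply branch_Hopf; assumption.
Qed.
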